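(* Let $R$ be a finite commutative ring whose Jacobson radical $\mathrm{rad}(R)$ has zero-square, i.e. $\mathrm{rad}(R)^2=0$, and let $n\ge 1$ be a natural number. Then every matrix $A\in \mathbb{M}_n(R)$ can be expressed as $A=P+N$, where $P\in\mathbb{M}_n(R)$ is a potent matrix and $N\in\mathbb{M}_n(R)$ is a nilpotent matrix with $N^2=0$.
   Context: $\mathbb{M}_n(R)$ denotes the ring of $n\times n$ matrices over $R$. An element $y$ of a ring is called potent if there is a natural number $m\ge 2$ with $y^m=y$. *)

(* Defs.v *)
From mathcomp Require Import all_boot all_order all_algebra.

Set Implicit Arguments.
Unset Strict Implicit.
Unset Printing Implicit Defensive.

Import GRing.Theory.
Local Open Scope ring_scope.

(* The zero ring is allowed throughout. The library's idealr_closed requires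
   1 != 0 in the ring and also requires properness, so ideals are given here
   by the same closure condition without properness. *)
Definition ideal_set (R : finComPzRingType) (I : {set R}) : bool :=
  (0 \in I) &&
  [forall a : R, forall u in I, forall v in I, a * u + v \in I].

Definition maximal_ideal (R : finComPzRingType) (M : {set R}) : bool :=
  maxset [pred I : {set R} | ideal_set I && (I != [set: R])] M.

(* In the zero ring the intersection is empty, so this is the whole ring. *)
Definition jacobson_radical (R : finComPzRingType) : {set R} :=
  \bigcap_(M : {set R} | maximal_ideal M) M.

(* The ideal generated by the products x * y with x in I and y in J. *)
Definition ideal_mul (R : finComPzRingType) (I J : {set R}) : {set R} :=
  \bigcap_(K : {set R} | ideal_set K &&
                         ([set x * y | x in I, y in J] \subset K)) K.

Definition potent (R : pzRingType) (y : R) : Prop :=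
  exists2 m : nat, (2 <= m)%N & y ^+ m = y.

(* Main.v *)
Require Import Defs.
From HB Require Import structures.
From mathcomp Require Import all_boot all_order all_algebra.

Set Implicit Arguments.
Unset Strict Implicit.
Unset Printing Implicit Defensive.

Import GRing.Theory.
Local Open Scope ring_scope.

(** Why the theorem holds.

    Over a field F, let A be a square matrix acting on columns.  Choose an
    idempotent e with image im A, and split im (1 - e) = im q + im z, where im z
    is the kernel of A inside im (1 - e).  On im e + im q + im z the matrix A
    has the block form
        [ B C 0 ]
        [ 0 0 0 ]
        [ 0 0 0 ]
    with C injective and [ B C ] surjective.  Put Z : im e -> im q in the second
    row: the resulting E is strictly triangular, so E^2 = 0.  It turns the upper
    left corner into [ B C ; Z 0 ], which is invertible as soon as Z is
    bijective on the subspace of the x with B x in im C.  That subspace has the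
    dimension of im q, so such a Z exists (field_completion).  Thus A + E is
    invertible on im f, where f = e + q, and zero on im z.  Over a
    finite field this makes A + E potent, and A = (A + E) + (- E).

    The quadruple (e, q, E, G), where G inverts A + E + z, is described by
    polynomial identities only.  A finite commutative ring R maps onto its
    finitely many residue fields, and by the Chinese remainder theorem the
    quadruples found over these fields come from one quadruple over R that
    satisfies the identities modulo J = M_n(rad R), an ideal with J^2 = 0.

    It remains to undo the reduction modulo J (lift_completion).  Idempotents
    lift because an element of a finite ring has an idempotent power, and
    q' E e' is then a square-zero lift of E.  With c = f (A + E) f, which is
    potent because c + z is a unit of a finite ring, one has
        A + E = c + f A z + z A f + z A z,
    the last three terms lying in J.  The off-diagonal ones disappear by
    conjugating with 1 + j for some j in J; the last one, d = z A z, cannot be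
    conjugated away, but it is killed by E on both sides and d^2 = 0, so it is
    added to the square-zero part: N = d - E and P = A - N is conjugate to c. *)

(** * Finite rings and lifting modulo a square-zero ideal *)

Lemma idempotent_power (S : finPzRingType) (x : S) :
  exists k, x ^+ k.+1 * x ^+ k.+1 = x ^+ k.+1.
Proof.
have /injectivePn [i [j neq_ij eq_x]] :
    ~~ injectiveb (fun i : 'I_#|S|.+1 => x ^+ i).
  by apply/injectiveP => /leq_card; rewrite card_ord ltnn.
wlog lt_ij : i j neq_ij eq_x / (i < j)%N.
  move=> IH; case: (ltngtP i j) => [/IH|/IH|/val_inj/eqP]; first exact.
    by apply; rewrite // eq_sym.
  by rewrite (negPf neq_ij).
pose d := (j - i)%N.
have d_gt0 : (0 < d)%N by rewrite subn_gt0.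
have shift1 m : (i <= m)%N -> x ^+ (m + d) = x ^+ m.
  move=> le_im; rewrite -{1}(subnK le_im) -addnA [(i + _)%N]addnC.
  rewrite subnK 1?ltnW //.
  by rewrite exprD -[x ^+ j]eq_x -exprD subnK.
have shift t m : (i <= m)%N -> x ^+ (m + t * d) = x ^+ m.
  move=> le_im; elim: t => [|t IH]; first by rewrite addn0.
  by rewrite mulSnr addnA shift1 // (leq_trans le_im) ?leq_addr.
exists (i.+1 * d).-1; rewrite prednK ?muln_gt0 // -exprD shift //.
by rewrite (leq_trans (leqnSn i)) // leq_pmulr.
Qed.

(** With f := e + q, an idempotent, and z := 1 - f, this says that a lies in the
    corner f S f, that E is square-zero in the same corner because E maps e to q
    and e q = 0, and that a + E becomes right-invertible after adding z; in a
    finite ring right inverses are two-sided. *)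
Definition completion (S : pzRingType) (a e q E G : S) : Prop :=
  [/\ [/\ e * e = e, q * q = q, e * q = 0 & q * e = 0],
      [/\ e * a = a, a * (e + q) = a & q * E * e = E] &
      (a + E + (1 - e - q)) * G = 1].

Lemma idemX (S : pzRingType) (x : S) k : x * x = x -> x ^+ k.+1 = x.
Proof. by move=> xx; elim: k => // k IH; rewrite exprS IH. Qed.

Section Lift.
Variables (S : finPzRingType) (I : Type) (T : I -> pzRingType).
Variable phi : forall i, {rmorphism S -> T i}.
(* A common kernel is a two-sided ideal by construction, and congruences modulo
   it can be checked in each T i. *)
Let J (x : S) := forall i, phi i x = 0.
Hypothesis J2 : forall x y, J x -> J y -> x * y = 0.

Lemma lift_idempotent (x : S) :
    (forall i, phi i x * phi i x = phi i x) ->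
  exists k, x ^+ k.+1 * x ^+ k.+1 = x ^+ k.+1 /\
    forall i, phi i (x ^+ k.+1) = phi i x.
Proof.
move=> xx; have [k kP] := idempotent_power x; exists k; split=> // i.
by rewrite rmorphXn /= idemX.
Qed.

(** In a finite monoid an idempotent power of a right-invertible element can be
    cancelled, so it is 1; right-invertibility itself lifts by
    (1 + t) (1 - t) = 1 for t in J. *)
Lemma lift_unit (u g : S) :
  (forall i, phi i (u * g) = 1) -> exists k, u ^+ k.+1 = 1.
Proof.
move=> ug1; have [k kP] := idempotent_power u; exists k.
have [v uv] : exists v, u * v = 1.
  exists (g * (1 - (u * g - 1))); rewrite mulrA mulrBr mulr1.
  have : (u * g - 1) * (u * g - 1) = 0.
    by apply: J2 => i; rewrite rmorphB rmorph1 ug1 subrr.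
  rewrite mulrBl mul1r => /eqP; rewrite subr_eq0 => /eqP ->.
  by rewrite opprB addrC subrK.
have uvX m : u ^+ m * v ^+ m = 1.
  elim: m => [|m IH]; first by rewrite mulr1.
  by rewrite exprSr exprS mulrA -(mulrA _ u) uv mulr1.
by rewrite -[RHS](uvX k.+1) -[in RHS]kP -mulrA uvX mulr1.
Qed.

Lemma conj_potent (c j j' : S) : j' * j = 1 -> potent c -> potent (j * c * j').
Proof.
move=> jj [m m2 cm]; exists m => //.
have H k : (j * c * j') ^+ k.+1 = j * c ^+ k.+1 * j'.
  elim: k => [|k IH]; first by rewrite !expr1.
  by rewrite exprS IH (exprS c k.+1) !mulrA;
     congr (_ * _ * _); rewrite -(mulrA _ j' j) jj mulr1.
by case: m m2 cm => // m _; rewrite H => ->.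
Qed.

(** The elements e and q can only be lifted with their orthogonality preserved
    if q is first cut down to the corner of 1 - e'.  After that the off-diagonal
    part of a is removed by conjugation, and its (1 - f)-block, which lies in J,
    is moved into the square-zero summand. *)
Lemma lift_completion (a e q E G : S) :
    (forall i, completion (phi i a) (phi i e) (phi i q) (phi i E) (phi i G)) ->
  exists P N : S, [/\ a = P + N, potent P & N ^+ 2 = 0].
Proof.
move=> comp.
have [|k [ee' phie]] := @lift_idempotent e.
- by move=> i; have [[]] := comp i.
move: (e ^+ k.+1) ee' phie => e1 ee phie {k}.
have phiq0 i : phi i ((1 - e1) * q * (1 - e1)) = phi i q.
  have [[_ _ eq0 qe0] _ _] := comp i.
  rewrite !rmorphM !rmorphB rmorph1 phie mulrBl mul1r eq0 subr0.
  by rewrite mulrBr mulr1 qe0 subr0.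
have [|k [qq phiq]] := @lift_idempotent ((1 - e1) * q * (1 - e1)).
- by move=> i; rewrite !phiq0; have [[]] := comp i.
have eq0 : e1 * ((1 - e1) * q * (1 - e1)) ^+ k.+1 = 0.
  by rewrite exprS !mulrA (mulrBr e1) mulr1 ee subrr !mul0r.
have qe0 : ((1 - e1) * q * (1 - e1)) ^+ k.+1 * e1 = 0.
  by rewrite exprSr -!mulrA (mulrBl e1) mul1r ee subrr !mulr0.
have {}phiq i := etrans (phiq i) (phiq0 i).
move: (_ ^+ k.+1) qq phiq eq0 qe0 => q1 qq phiq eq0 qe0 {k phiq0}.
pose E1 := q1 * E * e1; pose f := e1 + q1; pose z := 1 - f.
have ff : f * f = f by rewrite mulrDl !mulrDr ee eq0 qe0 qq addr0 add0r.
have fz : f * z = 0 by rewrite mulrBr mulr1 ff subrr.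
have zf : z * f = 0 by rewrite mulrBl mul1r ff subrr.
have zz : z * z = z by rewrite {1}/z mulrBl mul1r fz subr0.
have fDz : f + z = 1 by rewrite addrC subrK.
have fE : f * E1 = E1 by rewrite mulrDl !mulrA eq0 qq !mul0r add0r.
have Ef : E1 * f = E1 by rewrite mulrDr /E1 -!mulrA eq0 ee !mulr0 addr0.
have zE : z * E1 = 0 by rewrite mulrBl mul1r fE subrr.
have Ez : E1 * z = 0 by rewrite mulrBr mulr1 Ef subrr.
have EE : E1 * E1 = 0 by rewrite /E1 -!mulrA (mulrA e1 q1) eq0 mul0r !mulr0.
have phif i : phi i f = phi i e + phi i q by rewrite rmorphD phie phiq.
have phiE i : phi i E1 = phi i E.
  by rewrite !rmorphM phie phiq; have [_ []] := comp i.
clearbody E1 f.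
have phiaf i : phi i a * phi i f = phi i a.
  by rewrite phif; have [_ []] := comp i.
have phifa i : phi i f * phi i a = phi i a.
  have [[_ _ _ qe] [ea _ _] _] := comp i.
  by rewrite phif mulrDl -{2}ea mulrA qe mul0r addr0.
have Jaz : J (a * z).
  by move=> i; rewrite rmorphM rmorphB rmorph1 mulrBr mulr1 phiaf subrr.
have Jza : J (z * a).
  by move=> i; rewrite rmorphM rmorphB rmorph1 mulrBl mul1r phifa subrr.
have JMl x y : J x -> J (y * x) by move=> Jx i; rewrite rmorphM Jx mulr0.
have JMr x y : J x -> J (x * y) by move=> Jx i; rewrite rmorphM Jx mul0r.
pose c := f * (a + E1) * f; pose U := c + z.
have cE : c = f * a * f + E1 by rewrite /c (mulrDr f) fE (mulrDl _ E1) Ef.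
have [|k Uk] := @lift_unit U G.
  move=> i; have [_ _ <-] := comp i.
  rewrite rmorphM /U cE /z !rmorphD !rmorphN !rmorphM rmorph1 /= phifa phiaf.
  by rewrite phiE phif opprD !addrA.
have fc : f * c = c by rewrite /c !mulrA ff.
have cf : c * f = c by rewrite /c -!mulrA ff.
have zc : z * c = 0 by rewrite /c !mulrA zf !mul0r.
have cz : c * z = 0 by rewrite /c -!mulrA fz !mulr0.
have Uf : U * f = c by rewrite mulrDl zf addr0.
have fU : f * U = c by rewrite mulrDr fz addr0 fc.
(* V is the inverse of U, hence inverts c inside the corner of f. *)
pose V := U ^+ k.
have UV : U * V = 1 by rewrite -exprS.
have VU : V * U = 1 by rewrite -exprSr.
have Vc : V * c = f by rewrite -Uf mulrA VU mul1r.
have cV : c * V = f by rewrite -fU -mulrA UV mulr1.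
have c_potent : potent c.
  exists k.+2 => //.
  have cX m : c ^+ m.+1 = U ^+ m.+1 * f.
    elim: m => [|m IH]; first by rewrite !expr1.
    have fcX : f * c ^+ m.+1 = c ^+ m.+1 by rewrite exprS mulrA fc.
    by rewrite exprS -{1}Uf -mulrA fcX IH mulrA -exprS.
  by rewrite cX exprS Uk mulr1.
pose x := f * a * z; pose y := z * a * f; pose d := z * a * z.
have Jx : J x by rewrite /x -mulrA; apply: JMl.
have Jy : J y by apply: JMr.
have Jd : J d by apply: JMr.
have fx : f * x = x by rewrite /x !mulrA ff.
have yf : y * f = y by rewrite /y -!mulrA ff.
have xc : x * c = 0 by rewrite /x -mulrA zc mulr0.
have cy : c * y = 0 by rewrite /y !mulrA cz !mul0r.
have aE : a = f * a * f + x + (y + d).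
  by rewrite /x /y /d -!mulrDr fDz !mulr1 -mulrDl fDz mul1r.
have dd := J2 Jd Jd.
have dE : d * E1 = 0 by rewrite /d -mulrA zE mulr0.
have Ed : E1 * d = 0 by rewrite /d !mulrA Ez !mul0r.
clearbody x y d c V.
(* j solves j c - c j = x + y, so that conjugating c by 1 + j produces exactly
   the off-diagonal blocks x and y; higher terms vanish as J has square zero. *)
pose j := y * V - V * x.
have Jj : J j.
  by move=> i; rewrite rmorphB (JMr _ _ Jy) (JMl _ _ Jx) subrr.
have jc : j * c = y by rewrite mulrBl -!mulrA Vc xc mulr0 subr0.
have cj : c * j = - x by rewrite mulrBr !mulrA cy cV mul0r sub0r fx.
have jj := J2 Jj Jj; have yj := J2 Jy Jj; clearbody j.
exists ((1 + j) * c * (1 - j)), (d - E1); split.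
- rewrite mulrDl mul1r jc mulrDl !mulrBr !mulr1 cj yj subr0 opprK cE {1}aE.
  rewrite -!addrA; congr (_ + _).
  by rewrite [RHS]addrC -!addrA addNr addr0.
- apply: conj_potent => //.
  by rewrite mulrDr mulr1 mulrBl mul1r jj subr0 addrNK.
- by rewrite expr2 mulrBl !mulrBr EE dd dE Ed !subr0.
Qed.
End Lift.

(** * Completing a matrix over a field *)

Lemma idempotent_factor (F : fieldType) n r (x : 'M[F]_n) :
    x * x = x -> \rank x = r ->
  exists (s : 'M_(n, r)) (t : 'M_(r, n)), s *m t = x /\ t *m s = 1%:M.
Proof.
move=> xx rk.
have [c [d [s [t [cd sc dt]]]]] : exists (c : 'M_(n, r)) (d : 'M_(r, n)) s t,
    [/\ c *m d = x, s *m c = 1%:M & d *m t = 1%:M].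
  rewrite -rk; have [s sP] := row_fullP (col_base_full x).
  have [t tP] := row_freeP (row_base_free x).
  by exists (col_base x), (row_base x), s, t; rewrite mulmx_base.
exists c, d; split=> //.
have -> : d *m c = s *m (x *m x) *m t.
  by rewrite -cd !mulmxA sc mul1mx -!mulmxA dt mulmx1.
by rewrite mulmxE xx -cd mulmxA sc mul1mx dt.
Qed.

(** Both idempotents factor the identity of an r-dimensional space; exchanging
    the factors gives a and b. *)
Lemma idempotents_same_rank (F : fieldType) n (p h : 'M[F]_n) :
    p * p = p -> h * h = h -> \rank p = \rank h ->
  exists a b, [/\ p * a = a, a * h = a, a * b = p & b * a = h].
Proof.
move=> pp hh rk.
have [r rh] : exists r, \rank h = r by exists (\rank h).
have [s [t [<- ts]]] := idempotent_factor pp (etrans rk rh).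
have [s' [t' [<- ts']]] := idempotent_factor hh rh.
exists (s *m t'), (s' *m t); rewrite -!mulmxE.
by split; rewrite -!mulmxA; congr (_ *m _);
   rewrite !mulmxA ?ts ?ts' ?mul1mx // -mulmxA ts' mulmx1.
Qed.

Lemma rank_orthogonal_idempotents (F : fieldType) n (p g : 'M[F]_n) :
    p * p = p -> g * g = g -> p * g = 0 -> g * p = 0 ->
  \rank (p + g)%R = (\rank p + \rank g)%N.
Proof.
move=> pp gg pg gp; apply/eqP; rewrite eqn_leq mxrank_add /=.
have dis : (p :&: g = 0)%MS.
  apply/eqP; rewrite -submx0; apply/row_subP => i.
  have := row_sub i (p :&: g)%MS; rewrite sub_capmx.
  move=> /andP [/submxP [D ->] /submxP [D']].
  move/(congr1 (mulmx^~ p)); rewrite -!mulmxA !mulmxE pp gp mulmx0 => ->.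
  exact: sub0mx.
rewrite -(mxrank_disjoint_sum dis); apply: mxrankS; rewrite addsmx_sub.
have pE : p * (p + g) = p by rewrite mulrDr pp pg addr0.
have gE : g * (p + g) = g by rewrite mulrDr gp gg add0r.
by apply/andP; split;
   [rewrite -[X in (X <= _)%MS]pE | rewrite -[X in (X <= _)%MS]gE];
   apply: submxMl.
Qed.

(** In the block form of A on im e + im q + im (1 - e - q), C = A (1 - e) is
    the restriction of A to im (1 - e), Y is an inverse of C from im C to im q, p
    is the projection on im C and g = e - p, T = g A.  The idempotent h projects on
    the kernel of T inside im e, that is on the x with A x in im C; X is a right
    inverse of T.  As T is onto im g, the ranks of h and p agree, and
    a : im h -> im p followed by Y is the new block E.  Solving
    (A + E) x = y first for the component T x, then on im h and finally
    on im q yields the inverse v. *)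
Lemma field_completion (F : fieldType) n (A : 'M[F]_n) :
  exists e q E G : 'M[F]_n, completion A e q E G.
Proof.
have inner (B : 'M[F]_n) : exists u, B * u * B = B.
  by exists (pinvmx B); rewrite -!mulmxE mulmxKpV.
have [u AuA] := inner A.
pose e := A * u.
have ee : e * e = e by rewrite /e mulrA AuA.
have eA : e * A = A by [].
have AuE : A * u = e by [].
clearbody e.
pose C := A * (1 - e).
have eC : e * C = C by rewrite /C mulrA eA.
have ee0 : (1 - e) * e = 0 by rewrite mulrBl mul1r ee subrr.
have e0e : e * (1 - e) = 0 by rewrite mulrBr mulr1 ee subrr.
have Ce : C * e = 0 by rewrite /C -mulrA ee0 mulr0.
have AE : A = A * e + C by rewrite /C mulrBr mulr1 addrC subrK.
clearbody C; have [w CwC] := inner C.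
pose Y := (1 - e) * w * e.
have Ye : Y * e = Y by rewrite /Y -!mulrA ee.
have eY : e * Y = 0 by rewrite /Y !mulrA e0e !mul0r.
have CY : C * Y = C * w * e.
  by rewrite /Y mulrBl mul1r mulrBl mulrBr !mulrA Ce !mul0r subr0.
have CYC : C * Y * C = C by rewrite CY -mulrA eC.
have AY : A * Y = C * Y by rewrite {1}AE mulrDl -mulrA eY mulr0 add0r.
clearbody Y.
pose p := C * Y; pose q := Y * C; pose g := e - p; pose X := e * u * g.
have pp : p * p = p by rewrite /p mulrA CYC.
have pe : p * e = p by rewrite /p -mulrA Ye.
have ep : e * p = p by rewrite /p mulrA eC.
have gg : g * g = g by rewrite /g mulrBl !mulrBr ee pp ep pe subrr subr0.
have eg : e * g = g by rewrite /g mulrBr ee ep.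
have ge : g * e = g by rewrite /g mulrBl ee pe.
have gp : g * p = 0 by rewrite /g mulrBl ep pp subrr.
have pg : p * g = 0 by rewrite /g mulrBr pe pp subrr.
have gC : g * C = 0 by rewrite /g mulrBl eC /p CYC subrr.
pose T := g * A.
have Te : T * e = T by rewrite /T [in RHS]AE mulrDr gC addr0 mulrA.
have gT : g * T = T by rewrite /T mulrA gg.
have eX : e * X = X by rewrite /X !mulrA ee.
have Xg : X * g = X by rewrite /X -!mulrA gg.
have TX : T * X = g by rewrite /X !mulrA Te -(mulrA g) AuE ge gg.
have epg : e = p + g by rewrite addrC subrK.
have pC : p * C = C by [].
have CYp : C * Y = p by [].
have AYp : A * Y = p by rewrite AY.
have TY : T * Y = 0 by rewrite /T -mulrA AYp gp.
have pA : p * A = A - T by rewrite /T /g mulrBl eA opprB addrC subrK.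
clearbody g X p T.
pose h := e - X * T.
have eh : e * h = h by rewrite /h mulrBr ee mulrA eX.
have he : h * e = h by rewrite /h mulrBl ee -mulrA Te.
have Th : T * h = 0 by rewrite /h mulrBr Te mulrA TX gT subrr.
have hX : h * X = 0 by rewrite /h mulrBl eX -mulrA TX Xg subrr.
have hh : h * h = h by rewrite {1}/h mulrBl eh -mulrA Th mulr0 subr0.
have hY : h * Y = 0 by rewrite /h mulrBl eY -mulrA TY mulr0 subr0.
(* e = h + X T = p + g are orthogonal sums, and T, X identify im g with
   im (X T); dimensions can therefore be cancelled. *)
have rk : \rank p = \rank h.
  have eE : e = h + X * T by rewrite subrK.
  have kk : X * T * (X * T) = X * T by rewrite mulrA -(mulrA X T) TX Xg.
  have hk : h * (X * T) = 0 by rewrite mulrA hX mul0r.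
  have kh : X * T * h = 0 by rewrite -mulrA Th mulr0.
  have rg : \rank g = \rank (X * T)%R.
    apply/eqP; rewrite eqn_leq; apply/andP; split.
      have -> : g = T * (X * T) * X by rewrite mulrA TX -mulrA TX gg.
      exact: leq_trans (mxrankM_maxl _ _) (mxrankM_maxr _ _).
    rewrite -gT mulrA; exact: leq_trans (mxrankM_maxl _ _) (mxrankM_maxr _ _).
  apply/eqP; rewrite -(eqn_add2r (\rank g)).
  rewrite -(rank_orthogonal_idempotents pp gg pg gp).
  by rewrite -epg {1}eE rg rank_orthogonal_idempotents.
clearbody h; have [a [b [pa ah ab ba]]] := idempotents_same_rank pp hh rk.
have hb : h * b = b * p by rewrite -ba -mulrA ab.
have aX : a * X = 0 by rewrite -ah -mulrA hX mulr0.
have aY : a * Y = 0 by rewrite -ah -mulrA hY mulr0.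
have ae : a * e = a by rewrite -{1}ah -mulrA he ah.
have Tbp : T * (b * p) = 0 by rewrite -hb mulrA Th mul0r.
pose s := X + b * C; pose v := s + Y - Y * A * s; pose E := Y * a.
have Ts : T * s = g.
  by rewrite /s mulrDr TX -pC (mulrA b) (mulrA T) Tbp mul0r addr0.
have qE : q * E = E by rewrite /q /E !mulrA -(mulrA Y) CYp -mulrA pa.
have Ee : E * e = E by rewrite /E -mulrA ae.
have Av : A * v = e.
  rewrite /v mulrBr mulrDr AYp !mulrA AYp.
  by rewrite pA mulrBl Ts opprB addrC addrA subrK addrC -epg.
have aS : a * s = C by rewrite /s mulrDr aX add0r mulrA ab pC.
have EY : E * Y = 0 by rewrite /E -mulrA aY mulr0.
have Ev : E * v = q.
  by rewrite /v mulrBr mulrDr !mulrA EY !mul0r addr0 subr0 /E -mulrA aS.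
have eq0 : e * q = 0 by rewrite /q mulrA eY mul0r.
have qe0 : q * e = 0 by rewrite /q -mulrA Ce mulr0.
have qq : q * q = q by rewrite /q mulrA -(mulrA Y) CYp -mulrA pC.
have Aq : A * q = C by rewrite /q mulrA AYp.
(* v inverts A + E from the right only up to its component in im (1 - e - q),
   which is replaced by the identity. *)
exists e, q, E, (v + (1 - e - q) * (1 - v)); split.
- by [].
- by rewrite mulrDr Aq -AE qE Ee.
set z := 1 - e - q.
have Az : A * z = 0 by rewrite /z !mulrBr mulr1 Aq {1}AE addrAC addrK subrr.
have Eq : E * q = 0 by rewrite -Ee -mulrA eq0 mulr0.
have Ez : E * z = 0 by rewrite /z !mulrBr mulr1 Ee Eq subrr subr0.
have zz : z * z = z.
  by rewrite {1}/z -addrA -opprD mulrBl mul1r mulrDl /z !mulrBr !mulr1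
    ee qq eq0 qe0 !subr0 !subrr addr0 subr0.
have efz : e + q + z = 1 by rewrite addrC /z -[1 - e - q]addrA -opprD subrK.
clearbody z E v.
have Uz : (A + E + z) * z = z by rewrite !mulrDl Az Ez zz !add0r.
rewrite mulrDr mulrA Uz mulrBr mulr1 !mulrDl Av Ev.
by rewrite -addrA [z * v + _]addrC subrK.
Qed.

(** * Residue fields and the Chinese remainder theorem *)

Section Ideals.
Variable R : finComPzRingType.

Lemma idealP (K : {set R}) : ideal_set K ->
  0 \in K /\ {in K &, forall u v, forall a, a * u + v \in K}.
Proof.
move=> /andP [K0 /forallP HK]; split=> // u v Ku Kv a.
by have /forall_inP /(_ u Ku) /forall_inP /(_ v Kv) := HK a.
Qed.

Lemma ideal_set_intro (K : {set R}) : 0 \in K ->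
  {in K &, forall u v, forall a, a * u + v \in K} -> ideal_set K.
Proof.
move=> K0 HK; rewrite /ideal_set K0; apply/forallP => a.
by apply/forall_inP => u Ku; apply/forall_inP => v Kv; apply: HK.
Qed.

Lemma ideal_full (K : {set R}) : ideal_set K -> 1 \in K -> K = [set: R].
Proof.
move=> /idealP [K0 HK] K1; apply/setP => x; rewrite inE.
by rewrite -[x]addr0 -[x in x + 0]mulr1 HK.
Qed.

Lemma maximal_ideal_inv (M : {set R}) x :
  maximal_ideal M -> x \notin M -> exists y, 1 - y * x \in M.
Proof.
move=> /maxsetP [/andP [idM M1] maxM] xM; have [M0 HM] := idealP idM.
pose K := [set z | [exists y, z - y * x \in M]].
have sMK : M \subset K.
  apply/subsetP => z zM; rewrite inE; apply/existsP; exists 0.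
  by rewrite mul0r subr0.
have idK : ideal_set K.
  apply: ideal_set_intro => [|u v]; first exact: (subsetP sMK).
  move=> + + a; rewrite !inE => /existsP [y yP] /existsP [t tP].
  apply/existsP; exists (a * y + t).
  have -> : a * u + v - (a * y + t) * x = a * (u - y * x) + (v - t * x).
    by rewrite mulrBr mulrDl opprD mulrA addrACA.
  exact: HM.
have xK : x \in K.
  by rewrite inE; apply/existsP; exists 1; rewrite mul1r subrr.
have : K == [set: R].
  apply: contraR xM => KT; rewrite -(maxM K) //.
  by rewrite inE idK.
by move=> /eqP KT; have := in_setT (1 : R); rewrite -KT inE => /existsP.
Qed.

(** The value is a sigma type, not an existential, because the residue fields of
    all the maximal ideals are used simultaneously as a family of types. *)
Lemma residue_field (M : {set R}) : maximal_ideal M ->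
  {F : fieldType & {f : {rmorphism R -> F} |
    (forall y, exists x, f x = y) /\ (forall x, (f x == 0) = (x \in M))}}.
Proof.
move=> maxM; have /maxsetP [/andP [idM neqM] _] := maxM.
have [M0 HM] := idealP idM.
have M1 : 1 \notin M by apply: contra neqM => /(ideal_full idM) ->.
(* A proper ideal exists, so R is nonzero and the quotient construction for
   nontrivial rings applies. *)
have nz : (1 : R) != 0 by apply: contraNneq M1 => ->.
pose nzR := GRing.PzSemiRing_isNonZero.Build R nz.
pose R' : comNzRingType := HB.pack R nzR.
pose P : R' -> bool := mem M.
have idP : idealr_closed (P : {pred R'}).
  by split=> // a u v uM vM; apply: HM.
pose Iid : idealr R' := HB.pack P (isIdealr.Build R' P idP).
pose Q := {ideal_quot Iid}.
have piE (x : R') : ((\pi_Q x)%qT == 0) = (x \in M).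
  by have := Quotient.idealrBE Iid x 0; rewrite subr0 rmorph0 => <-.
have invP (u : Q) : exists v : Q,
    ((u != 0) ==> (v * u == 1)) && ((u == 0) ==> (v == 0)).
  have [->|u0] := eqVneq u 0; first by exists 0; rewrite eqxx.
  have [|y yP] := @maximal_ideal_inv M (repr u) maxM.
    by rewrite -piE reprK.
  exists (\pi y)%qT; rewrite andbT /=.
  rewrite eq_sym -subr_eq0 -{1}[u]reprK -rmorphM -(rmorph1 (\pi_Q)%qT) -rmorphB.
  by rewrite piE.
pose inv u := xchoose (invP u).
have mulVf (u : Q) : u != 0 -> inv u * u = 1.
  by move=> u0; have /andP [/implyP /(_ u0) /eqP] := xchooseP (invP u).
have inv0 : inv 0 = 0.
  by have /andP [_ /implyP /(_ (eqxx _)) /eqP] := xchooseP (invP 0).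
pose F : fieldType := HB.pack Q (GRing.ComNzRing_isField.Build Q mulVf inv0).
exists F; exists (\pi_Q%qT : {rmorphism R' -> Q}).
split=> [y|x]; last exact: piE.
by exists (repr (y : Q)); rewrite /= reprK.
Qed.

Definition max_spec := {M : {set R} | maximal_ideal M}.

Definition residue_at (i : max_spec) : fieldType :=
  projT1 (residue_field (valP i)).

Definition residue (i : max_spec) : {rmorphism R -> residue_at i} :=
  sval (projT2 (residue_field (valP i))).

Lemma residue_surj i y : exists x, residue i x = y.
Proof. exact: (svalP (projT2 (residue_field (valP i)))).1. Qed.

Lemma residue_eq0 i x : (residue i x == 0) = (x \in val i).
Proof. exact: (svalP (projT2 (residue_field (valP i)))).2. Qed.

Lemma mem_jacobson x :
  reflect (forall i, residue i x = 0) (x \in jacobson_radical R).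
Proof.
apply: (iffP bigcapP) => [xJ i|x0 M maxM].
  by apply/eqP; rewrite residue_eq0; apply: xJ; apply: valP.
by rewrite -[M]/(val (Sub M maxM : max_spec)) -residue_eq0 x0.
Qed.

(** An element of the second ideal outside the first, scaled to be 1 in the
    residue field of the first. *)
Lemma separate_maximal i j : j != i ->
  exists w, residue i w = 1 /\ residue j w = 0.
Proof.
move=> neq_ji.
have /subsetPn [x xj xi] : ~~ (val j \subset val i).
  apply: contra neq_ji => sji; apply/eqP/val_inj.
  have /maxsetP [_ maxj] := valP j; symmetry; apply: maxj => //.
  by have /maxsetP [] := valP i.
have [y yx] : exists y, residue i y = (residue i x)^-1 by apply: residue_surj.
exists (y * x); split; rewrite rmorphM.
  by rewrite yx mulVf // residue_eq0.
by apply/eqP; rewrite mulf_eq0 !residue_eq0 xj orbT.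
Qed.

Lemma chinese_remainder (x : max_spec -> R) :
  exists y, forall i, residue i y = residue i (x i).
Proof.
have /fin_all_exists [w wP] i : exists w,
    residue i w = 1 /\ forall j, j != i -> residue j w = 0.
  have /fin_all_exists [v vP] j : exists v,
      residue i v = 1 /\ (j != i -> residue j v = 0).
    have [->|/separate_maximal [v [v1 v0]]] := eqVneq j i; last by exists v.
    by exists 1; rewrite rmorph1.
  exists (\prod_j v j); split=> [|j ji]; rewrite rmorph_prod.
    by rewrite big1 // => j _; have [] := vP j.
  by rewrite (bigD1 j) //= (proj2 (vP j)) // mul0r.
exists (\sum_j w j * x j) => i.
rewrite rmorph_sum (bigD1 i) //= rmorphM (proj1 (wP i)) mul1r big1 ?addr0 //.
by move=> j ji; rewrite rmorphM (proj2 (wP j)) ?mul0r // eq_sym.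
Qed.

Lemma chinese_remainder_mx m n (B : forall i, 'M[residue_at i]_(m, n)) :
  exists Y : 'M[R]_(m, n), forall i, map_mx (residue i) Y = B i.
Proof.
have /fin_all_exists [f fP] (rc : 'I_m * 'I_n) :
    exists y, forall i, residue i y = B i rc.1 rc.2.
  have /fin_all_exists [x xP] i := residue_surj (B i rc.1 rc.2).
  by have [y yP] := chinese_remainder x; exists y => i; rewrite yP.
by exists (\matrix_(r, c) f (r, c)) => i; apply/matrixP => r c; rewrite !mxE fP.
Qed.

Lemma jacobson_mul0 x y :
    ideal_mul (jacobson_radical R) (jacobson_radical R) = [set 0] ->
  x \in jacobson_radical R -> y \in jacobson_radical R -> x * y = 0.
Proof.
move=> sq0 xJ yJ; apply/set1P; rewrite -sq0; apply/bigcapP => K /andP [_].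
by move/subsetP; apply; apply/imset2P; exists x y.
Qed.
End Ideals.

(** * The decomposition *)

Theorem theorem2p6 (R : finComPzRingType)
    (rad_sq0 : ideal_mul (jacobson_radical R) (jacobson_radical R) = [set 0])
    (n : nat) (n_ge1 : (1 <= n)%N) (A : 'M[R]_n) :
  exists P N : 'M[R]_n, [/\ A = P + N, potent P & N ^+ 2 = 0].
Proof.
pose phi i : {rmorphism 'M[R]_n -> 'M[residue_at i]_n} := map_mx (residue i).
have phi0 X : (forall i : max_spec R, phi i X = 0) ->
    forall r c, X r c \in jacobson_radical R.
  move=> X0 r c; apply/mem_jacobson => i.
  by have := congr1 (fun Y : 'M_n => Y r c) (X0 i); rewrite !mxE.
have J2 X Y : (forall i : max_spec R, phi i X = 0) ->
    (forall i : max_spec R, phi i Y = 0) -> X * Y = 0.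
  move=> /phi0 X0 /phi0 Y0; rewrite -mulmxE; apply/matrixP => r c.
  by rewrite !mxE big1 // => k _; rewrite (jacobson_mul0 rad_sq0).
have /fin_all_exists [e /fin_all_exists [q /fin_all_exists [E
    /fin_all_exists [G compl]]]] := fun i => field_completion (phi i A).
have [e1 e1P] := chinese_remainder_mx e.
have [q1 q1P] := chinese_remainder_mx q.
have [E1 E1P] := chinese_remainder_mx E.
have [G1 G1P] := chinese_remainder_mx G.
pose S : finPzRingType := HB.pack 'M[R]_n.
apply: (@lift_completion S (max_spec R) _ phi J2 A e1 q1 E1 G1) => i.
by rewrite /= e1P q1P E1P G1P; apply: compl.
Qed.
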